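(* Let $h>0$ be fixed and let $Y(t):[0,\infty)\to\mathbb R$ be a centered continuous Gaussian process with stationary increments, covariance function $R_Y(s,t)$ and variance function $V_Y(t)=R_Y(t,t)$, extended by $V_Y(t)=V_Y(-t)$ for $t\in(-\infty,0)$. Let $X_Y(t)=Y(t+h)-Y(t)$ denote the increment process, with covariance function $\Gamma(t-s)=R(s,t)=E[X_Y(s)X_Y(t)]$, and let $f_Y^h(t)=V_Y(t+h)-V_Y(t)$ be the increment function. Assume that: (i) $f_Y^h$ is $C^2((0,\infty),\mathbb R)$; (ii) $(f_Y^h)'(t)>0$ for all $t\in\mathbb R$; (iii) for all $\beta\in[0,h]$, $(f_Y^h)''(t)+(f_Y^h)''(t-\beta)<0$ for all $t\in[0,\infty)\setminus\{\beta\}$. Assume also that $$C^\ast:=1+\frac{\Gamma(h)-\Gamma(2h)}{\Gamma(h)-\Gamma(0)}>0,$$ and that $$\gamma(t)=\Gamma(t)+C^\ast\Gamma(h-t)+\Gamma(2h-t)$$ has at most one critical point, a maximum, on $(0,h)$. Consider the interval $[a,b]$ with $b-a=2h$. Then the optimal measure associated to the optimization problem $$\sigma_\ast^2(a,b)=\inf_{\mu\in\mathcal M_1([a,b])}\int_a^b\int_a^b R(s,t)\,\mu(ds)\,\mu(dt)$$ for $X_Y$ is $$\mu^\ast=\frac{1}{2+C^\ast}\left(\delta_a+C^\ast\delta_{a+h}+\delta_b\right).$$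
   Context: $\mathcal M_1([a,b])$ denotes the space of Borel probability measures on $[a,b]$, and $\delta_x$ is the Dirac measure at $x$. An optimal measure for the problem $\sigma_\ast^2(a,b)$ is a measure $\mu^\ast\in\mathcal M_1([a,b])$ attaining the infimum.
   Formalization: Y(0)=0 almost surely is assumed, since otherwise (i)-(iii) do not constrain Γ and the claim can fail; condition (iii) is required only for t>0, t≠β, because at t=0, β=h it is contradictory (f''(-h) = -f''(0)). *)

(* Defs.v *)
From HB Require Import structures.
From mathcomp Require Import all_boot all_order all_algebra.
From mathcomp Require Import all_classical all_reals all_analysis.
Set Implicit Arguments.
Unset Strict Implicit.
Unset Printing Implicit Defensive.
Import Order.TTheory GRing.Theory Num.Theory.
Import numFieldNormedType.Exports.
Local Open Scope ring_scope.
Local Open Scope classical_set_scope.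

(* A process on [0, +oo[ is a family of random variables indexed by the whole
   of R, of which only the members of nonnegative index are ever used. *)
Section Processes.
Context (d : measure_display) (T : measurableType d) (R : realType).
Variable P : probability T R.

(* The degenerate laws are Dirac masses; [normal_prob m 0] is a junk value in
   the library (the uniform law on [0, 1]), hence the case distinction. *)
Definition gaussian_rv (Z : T -> R) : Prop :=
  exists m s : R, forall A : set R, measurable A ->
    P (Z @^-1` A) = if s == 0 then \d_m A else normal_prob m s A.

Definition gaussian_process (Y : R -> {RV P >-> R}) : Prop :=
  forall (n : nat) (t c : 'I_n -> R), (forall i, 0 <= t i) ->
    gaussian_rv (fun w => \sum_(i < n) c i * Y (t i) w).

Definition centered (Y : R -> {RV P >-> R}) : Prop :=
  forall t, 0 <= t -> 'E_P[Y t]%E = 0%E.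

Definition continuous_paths (Y : R -> {RV P >-> R}) : Prop :=
  {ae P, forall w, {within `[0, +oo[%classic, continuous (fun t => Y t w)}}.

(* (Y (t + s) - Y s)_t and (Y t - Y 0)_t have the same finite-dimensional
   laws; these are determined by their values on measurable rectangles. *)
Definition stationary_increments (Y : R -> {RV P >-> R}) : Prop :=
  forall (n : nat) (t : 'I_n -> R) (A : 'I_n -> set R) (s : R),
    0 <= s -> (forall i, 0 <= t i) -> (forall i, measurable (A i)) ->
    P [set w | forall i, A i (Y (t i + s) w - Y s w)] =
    P [set w | forall i, A i (Y (t i) w - Y 0 w)].

Definition covariance_function (Y : R -> {RV P >-> R}) (s t : R) : R :=
  fine (covariance P (Y s) (Y t)).

(* The absolute value is the even extension V_Y (- t) = V_Y t. *)
Definition variance_function (Y : R -> {RV P >-> R}) (t : R) : R :=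
  covariance_function Y `|t| `|t|.

Definition increment_process (Y : R -> {RV P >-> R}) (h t : R) : T -> R :=
  fun w => Y (t + h) w - Y t w.

Definition increment_function (Y : R -> {RV P >-> R}) (h t : R) : R :=
  variance_function Y (t + h) - variance_function Y t.

End Processes.

Section Calculus.
Context (R : realType).

(* [A] is meant to be open. *)
Definition C2_on (A : set R) (f : R -> R) : Prop :=
  forall t, A t -> [/\ derivable f t 1, derivable f^`() t 1 &
                      {for t, continuous f^`(2)}].

Definition critical_point (f : R -> R) (t : R) : Prop := is_derive t 1 f 0.

Definition local_max (f : R -> R) (t : R) : Prop := \forall s \near t, f s <= f t.

End Calculus.

Section OptimalMeasures.
Context (R : realType).
Implicit Types (mu nu : probability (measurableTypeR R) R).

(* Borel probability measures on [a, b] are seen as Borel probability measures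
   on R carried by [a, b]. *)
Definition M1 (a b : R) : set (probability (measurableTypeR R) R) :=
  [set mu | mu `[a, b]%classic = 1%E].

Definition energy (K : R -> R -> R) (a b : R) mu : \bar R :=
  (\int[mu]_(t in `[a, b]) \int[mu]_(s in `[a, b]) (K s t)%:E)%E.

Definition sigma2_star (K : R -> R -> R) (a b : R) : \bar R :=
  ereal_inf [set energy K a b mu | mu in M1 a b].

Definition optimal_measure (K : R -> R -> R) (a b : R) mu : Prop :=
  M1 a b mu /\ energy K a b mu = sigma2_star K a b.

Definition Cstar (Gamma : R -> R) (h : R) : R :=
  1 + (Gamma h - Gamma (2 * h)) / (Gamma h - Gamma 0).

Definition gamma_function (Gamma : R -> R) (h t : R) : R :=
  Gamma t + Cstar Gamma h * Gamma (h - t) + Gamma (2 * h - t).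

Definition mu_star (C a h b : R) (A : set R) : \bar R :=
  ((2 + C)^-1%:E * (\d_a A + C%:E * \d_(a + h)%R A + \d_b A))%E.

End OptimalMeasures.

(* Main.v *)
Require Import Defs.
From HB Require Import structures.
From mathcomp Require Import all_boot all_order all_algebra.
From mathcomp Require Import all_classical all_reals all_analysis.
From mathcomp Require Import measurable_realfun ring lra.
Import Order.TTheory GRing.Theory Num.Theory.
Import numFieldNormedType.Exports.
Local Open Scope ring_scope.
Local Open Scope classical_set_scope.

(** Write [G] for [Gamma] and [C] for [Cstar G h], and let the points be [a],
    [a + h] and [b = a + 2 h], with weights [w], [w C], [w] where
    [w = 1 / (2 + C)]; this is the candidate [m].

    The kernel [G (t - s)] is a covariance, hence positive semidefinite. The
    energy of a measure [mu] is a quadratic form in [mu], so that expanding it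
    around [m] gives
      energy mu = energy (mu - m) + 2 \int U dmu - energy m,
    where [U t] is the potential of [m], the average of [G (t - s)] over [s]
    distributed as [m]. The first term is nonnegative ([double_integral_ge0],
    [real_energy_ge]). On the left half of [a, b] the potential is [w] times
    [gamma_function], and the right half is its mirror image; [C] is chosen so
    that the potential takes the same value, the level, at the three points.
    Since [gamma_function] has at most one critical point between [0] and [h],
    which is a local maximum, it lies strictly above its common value at [0] and
    [h] ([gt_endpoints]). So [U] is at least the level, with equality only at
    the three points, and every energy is at least the level, which is also the
    energy of [m]. This is optimality.

    In case of equality the integral of [U] minus the level vanishes, so [mu] is
    carried by the three points ([carried_by_three_points]), and there remains a
    quadratic form in three masses ([minimizer_unique]). It is definite as
    soon as [C > 0], [G h < G 0] and [G (2 h) < G 0].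

    The last two inequalities come from the increment function [f]. Polarization
    of the variances gives [G t = (f t - f (t - h)) / 2]
    ([Gamma_increment_function]), and [f] is strictly concave on the positive
    half-line, so [G (h + p) < G h] whenever [p >= h]. A positive semidefinite
    [G] that took the value [G 0] at [p] would be [p]-periodic ([psd_lt0]), which
    is a contradiction. The same positivity yields the uniform continuity of [G]
    needed to discretize the integrals ([psd_uniformly_continuous]).

    Covariances make sense because Gaussian variables are square-integrable
    ([gaussian_rv_Lfun2]). *)

Set Implicit Arguments.
Unset Strict Implicit.
Unset Printing Implicit Defensive.

(** * Second moments of Gaussian variables *)

(** The density agrees almost everywhere with the Radon-Nikodym derivative, by
    uniqueness of the latter. *)
Lemma ge0_integral_density (R : realType) (nu : probability (measurableTypeR R) R)
    (g : R -> R) (f : R -> \bar R) :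
  nu `<< lebesgue_measure ->
  measurable_fun setT g ->
  (forall A, measurable A ->
     nu A = (\int[lebesgue_measure]_(x in A) (g x)%:E)%E) ->
  measurable_fun setT f -> (forall x, 0 <= f x)%E ->
  (\int[nu]_x f x = \int[lebesgue_measure]_x (f x * (g x)%:E))%E.
Proof.
move=> numu mg nuE mf f0.
have intRN := Radon_Nikodym_SigmaFinite.f_integrable numu.
rewrite -(Radon_Nikodym_SigmaFinite.change_of_variables numu)//.
apply: ae_eq_integral => //.
- by apply: emeasurable_funM => //; exact: measurable_int intRN.
- by apply: emeasurable_funM => //; exact/measurable_EFinP.
- apply: ae_eqe_mul2l; apply: integral_ae_eq => //.
  + exact/measurable_EFinP.
  + move=> A _ mA; rewrite -Radon_Nikodym_SigmaFinite.f_integral//.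
    exact: nuE.
Qed.

(** Doubling the standard deviation absorbs the square: the quotient of the two
    densities is, up to a constant, the exponential of a quadratic function of
    [x - m]. Finiteness of the second moment then needs no integration. *)
Lemma sqr_normal_pdf_le (R : realType) (m s : R) : s != 0 ->
  exists2 K : R, 0 <= K &
    forall x, x ^+ 2 * normal_pdf m s x <= K * normal_pdf m (2 * s) x.
Proof.
move=> s0; have s20 : 2 * s != 0 by rewrite mulf_neq0.
have s2gt0 : 0 < s ^+ 2 by rewrite exprn_even_gt0.
(* [x ^+ 2 <= 2 * m ^+ 2 + 2 * (x - m) ^+ 2], and [(x - m) ^+ 2] is
   [8 / 3 * s ^+ 2] times the exponent [u] that separates the two densities. *)
pose K := (2 * m ^+ 2 + 16 / 3 * s ^+ 2).
have K0 : 0 <= K by rewrite /K; have := sqr_ge0 m; lra.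
exists (K * (normal_peak s / normal_peak (2 * s))).
  by rewrite mulr_ge0// divr_ge0// normal_peak_ge0.
move=> x; rewrite !normal_pdfE//.
have -> : K * (normal_peak s / normal_peak (2 * s)) *
    (normal_peak (2 * s) * normal_fun m (2 * s) x)
    = normal_peak s * (K * normal_fun m (2 * s) x).
  by field; rewrite gt_eqF// normal_peak_gt0.
rewrite mulrCA ler_wpM2l ?normal_peak_ge0//.
pose u := 3 / 8 * ((x - m) ^+ 2 / s ^+ 2).
have -> : normal_fun m (2 * s) x = expR u * normal_fun m s x.
  rewrite /normal_fun -expRD /u; congr expR.
  by field.
rewrite mulrA ler_wpM2r ?expR_ge0//.
have u0 : 0 <= u by rewrite /u mulr_ge0 ?divr_ge0 ?sqr_ge0//; lra.
apply: (@le_trans _ _ (K * (1 + u))); last first.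
  by rewrite ler_wpM2l// expR_ge1Dx.
have xu : (x - m) ^+ 2 = 8 / 3 * s ^+ 2 * u by rewrite /u; field.
have m2 : 0 <= 2 * m ^+ 2 * u by rewrite mulr_ge0// mulr_ge0// sqr_ge0.
have : 0 <= (x - 2 * m) ^+ 2 by exact: sqr_ge0.
have -> : (x - 2 * m) ^+ 2 = 2 * (x - m) ^+ 2 + 2 * m ^+ 2 - x ^+ 2 by ring.
rewrite xu /K; nra.
Qed.

Lemma normal_prob_sqr_lty (R : realType) (m s : R) : s != 0 ->
  (\int[normal_prob m s]_x (x ^+ 2)%:E < +oo)%E.
Proof.
move=> s0; have [K K0 leK] := sqr_normal_pdf_le m s0.
have mX : measurable_fun [set: R] (fun x : R => x ^+ 2).
  exact: measurable_funX.
rewrite (@ge0_integral_density _ (normal_prob m s) (normal_pdf m s))//; first last.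
- by move=> x; rewrite lee_fin sqr_ge0.
- exact/measurable_EFinP.
- exact: measurable_normal_pdf.
- exact: normal_prob_dominates.
apply: (@le_lt_trans _ _
    (\int[lebesgue_measure]_x (K%:E * (normal_pdf m (2 * s) x)%:E))%E).
  apply: ge0_le_integral => //=.
  - by move=> x _; rewrite lee_fin mulr_ge0 ?sqr_ge0 ?normal_pdf_ge0.
  - apply/measurable_EFinP/measurable_funM => //.
    exact: measurable_normal_pdf.
  - apply/measurable_EFinP/measurable_funM => //.
    exact: measurable_normal_pdf.
  - by move=> x _; rewrite -EFinM lee_fin leK.
rewrite integralZl//; last exact: integrable_normal_pdf.
by rewrite integral_normal_pdf mule1 ltry.
Qed.

Lemma Lfun2P d (T : measurableType d) (R : realType) (P : probability T R)
    (X : T -> R) : measurable_fun setT X ->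
  (\int[P]_w (X w ^+ 2)%:E < +oo)%E -> X \in Lfun P 2%:E.
Proof.
move=> mX X2; rewrite inE; apply/andP; split; rewrite inE//=.
rewrite /finite_norm unlock /Lnorm poweR_lty//.
rewrite /=; by under eq_integral do rewrite powR_mulrn// real_normK ?num_real//.
Qed.

Lemma gaussian_rv_Lfun2 d (T : measurableType d) (R : realType)
    (P : probability T R) (Z : {RV P >-> R}) :
  gaussian_rv P Z -> (Z : T -> R) \in Lfun P 2%:E.
Proof.
move=> [m [s law]]; apply: Lfun2P => //.
(* The normal law lives on the sigma-algebra generated by the intervals, which
   has the measurable sets of [R] but another display. *)
have mZ : measurable_fun setT (Z : T -> measurableTypeR R).
  exact: (measurable_funP Z).
pose Z' : {mfun T >-> measurableTypeR R} :=
  HB.pack (Z : T -> measurableTypeR R) (isMeasurableFun.Build _ _ _ _ _ mZ).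
have mX : measurable_fun [set: measurableTypeR R] (fun x : R => (x ^+ 2)%:E).
  by apply/measurable_EFinP; exact: measurable_funX.
have -> : (\int[P]_w (Z w ^+ 2)%:E =
           \int[distribution P Z']_x (x ^+ 2)%:E)%E.
  rewrite (@ge0_integral_distribution _ _ _ (measurableTypeR R) _ _ Z')//.
  by move=> x; rewrite lee_fin sqr_ge0.
have [s0|s0] := eqVneq s 0.
  rewrite (@eq_measure_integral _ _ _ _ (@dirac _ (measurableTypeR R) m R)).
    by rewrite integral_dirac//= diracT mul1e ltry.
  by move=> A mA _; have := law A mA; rewrite s0 eqxx.
rewrite (@eq_measure_integral _ _ _ _ (normal_prob m s)).
  exact: normal_prob_sqr_lty.
by move=> A mA _; have := law A mA; rewrite (negbTE s0).
Qed.

(** * The Gram kernel of a family of square-integrable variables *)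

Definition inner d (T : measurableType d) (R : realType) (P : probability T R)
  (X Z : T -> R) : R := \int[P]_w (X w * Z w).

Section InnerProduct.
Context d (T : measurableType d) (R : realType) (P : probability T R).
Implicit Types X Y Z : T -> R.

Lemma integrable_mul X Z : X \in Lfun P 2%:E -> Z \in Lfun P 2%:E ->
  P.-integrable setT (EFin \o (fun w => X w * Z w)).
Proof. by move=> X2 Z2; apply/Lfun1_integrable; exact: Lfun2_mul_Lfun1. Qed.

Lemma Lfun2_lin (c : R) X Y : X \in Lfun P 2%:E -> Y \in Lfun P 2%:E ->
  (fun w => c * X w + Y w) \in Lfun P 2%:E.
Proof.
move=> X2 Y2; have le12 : (1 <= 2%:E :> \bar R)%E by rewrite lee1n.
apply: (@Lfun_addr_closed _ _ _ P _ le12).2 => //.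
have -> : (fun w => c * X w) = (c \o* X)%R by apply/funext => w /=; rewrite mulrC.
by apply: Lfun_scale => //; rewrite ler1n.
Qed.

Lemma innerC X Z : inner P X Z = inner P Z X.
Proof. by apply: eq_Rintegral => w _; rewrite mulrC. Qed.

Lemma inner_linl (c : R) X Y Z : X \in Lfun P 2%:E -> Y \in Lfun P 2%:E ->
  Z \in Lfun P 2%:E ->
  inner P (fun w => c * X w + Y w) Z = c * inner P X Z + inner P Y Z.
Proof.
move=> X2 Y2 Z2; have iXZ := integrable_mul X2 Z2.
have iYZ := integrable_mul Y2 Z2.
rewrite /inner -RintegralZl//.
rewrite -(@RintegralD _ _ _ _ _ (fun w => c * (X w * Z w)))//.
  by apply: eq_Rintegral => w _; rewrite mulrDl mulrA.
by have := integrableZl measurableT c iXZ.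
Qed.

Lemma subfE X Y : (fun w => X w - Y w) = (fun w => -1 * Y w + X w).
Proof. by apply/funext => w; rewrite mulN1r addrC. Qed.

Lemma Lfun2_sub X Y : X \in Lfun P 2%:E -> Y \in Lfun P 2%:E ->
  (fun w => X w - Y w) \in Lfun P 2%:E.
Proof. by move=> X2 Y2; rewrite subfE; exact: Lfun2_lin. Qed.

Lemma inner_subl X Y Z : X \in Lfun P 2%:E -> Y \in Lfun P 2%:E ->
  Z \in Lfun P 2%:E ->
  inner P (fun w => X w - Y w) Z = inner P X Z - inner P Y Z.
Proof. by move=> *; rewrite subfE inner_linl// mulN1r addrC. Qed.

Lemma inner_subr X Y Z : X \in Lfun P 2%:E -> Y \in Lfun P 2%:E ->
  Z \in Lfun P 2%:E ->
  inner P Z (fun w => X w - Y w) = inner P Z X - inner P Z Y.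
Proof. by move=> *; rewrite innerC inner_subl// !(innerC Z). Qed.

Lemma inner_ge0 X : 0 <= inner P X X.
Proof. by apply: Rintegral_ge0 => w _; rewrite -expr2 sqr_ge0. Qed.

End InnerProduct.

(** Finite families of weighted points are encoded as lists of pairs
    (weight, point): concatenating two lists adds the corresponding discrete
    signed measures. *)
Definition positive_semidefinite (R : realType) (K : R -> R -> R) : Prop :=
  forall s : seq (R * R),
    0 <= \sum_(p <- s) \sum_(q <- s) p.1 * q.1 * K p.2 q.2.

(** The double sum is the squared norm of the linear combination of the [X p.2]
    with coefficients [p.1]. *)
Lemma gram_psd d (T : measurableType d) (R : realType) (P : probability T R)
    (X : R -> T -> R) (s : seq (R * R)) :
  (forall p, p \in s -> X p.2 \in Lfun P 2%:E) ->
  0 <= \sum_(p <- s) \sum_(q <- s) p.1 * q.1 * inner P (X p.2) (X q.2).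
Proof.
move=> X2; pose S r w := \sum_(p <- r : seq (R * R)) p.1 * X p.2 w.
have S0 : S [::] = (cst 0 : T -> R) by apply/funext => w; rewrite /S big_nil.
have Scons p r : S (p :: r) = (fun w => p.1 * X p.2 w + S r w).
  by apply/funext => w; rewrite /S big_cons.
have S2 r : {subset r <= s} -> S r \in Lfun P 2%:E.
  elim: r => [|p r IH] rs; first by rewrite S0; exact: Lfun_cst.
  rewrite Scons; apply: Lfun2_lin; first by apply: X2; rewrite rs ?mem_head.
  by apply: IH => q qr; rewrite rs// inE qr orbT.
have inS r Z : {subset r <= s} -> Z \in Lfun P 2%:E ->
    inner P (S r) Z = \sum_(p <- r) p.1 * inner P (X p.2) Z.
  move=> + Z2; elim: r => [|p r IH] rs.
    rewrite S0 big_nil /inner; under eq_Rintegral do rewrite mul0r.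
    by rewrite Rintegral_cst ?mul0r.
  have rs' : {subset r <= s} by move=> q qr; rewrite rs// inE qr orbT.
  by rewrite Scons inner_linl ?S2 ?big_cons ?IH// X2// rs ?mem_head.
have := inner_ge0 P (S s); rewrite inS// ?S2//.
congr (_ <= _); rewrite !big_seq; apply: eq_bigr => p ps.
by rewrite innerC inS// ?X2// mulr_sumr; apply: eq_bigr => q _; rewrite innerC mulrA.
Qed.

(** * From the increments to the kernel *)

Lemma eq_law_inner d (T : measurableType d) (R : realType) (P : probability T R)
    (X Z : {mfun T >-> R}) :
  (forall A : set R, measurable A -> P (X @^-1` A) = P (Z @^-1` A)) ->
  inner P X X = inner P Z Z.
Proof.
move=> XZ; have mX : measurable_fun [set: R] (fun x : R => (x ^+ 2)%:E).
  by apply/measurable_EFinP; exact: measurable_funX.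
have moment (W : {mfun T >-> R}) : (\int[P]_w (W w * W w)%:E =
    \int[distribution P W]_x (x ^+ 2)%:E)%E.
  rewrite ge0_integral_distribution//.
  by move=> x; rewrite lee_fin sqr_ge0.
rewrite /inner /Rintegral !moment; congr fine.
by apply: eq_measure_integral => A mA _; exact: XZ.
Qed.

Section Process.
Context d (T : measurableType d) (R : realType) (P : probability T R).
Variable Y : R -> {RV P >-> R}.
Hypothesis Y_gaussian : gaussian_process Y.
Hypothesis Y_centered : centered Y.
Hypothesis Y_0 : {ae P, forall w, Y 0 w = 0}.
Hypothesis Y_stationary : stationary_increments Y.

Lemma gaussian_process_Lfun2 t : 0 <= t -> (Y t : T -> R) \in Lfun P 2%:E.
Proof.
move=> t0; apply: gaussian_rv_Lfun2.
have := Y_gaussian (n := 1) (t := fun=> t) (fun=> 1) (fun=> t0).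
congr gaussian_rv; apply/funext => w.
by rewrite big_ord1 mul1r.
Qed.

Lemma variance_functionE t : 0 <= t -> variance_function Y t = inner P (Y t) (Y t).
Proof.
move=> t0; rewrite /variance_function /covariance_function ger0_norm//.
rewrite unlock Y_centered//= unlock; congr fine.
by apply: eq_integral => w _; rewrite mulrfctE /= !subr0.
Qed.

Lemma variance_functionN t : variance_function Y (- t) = variance_function Y t.
Proof. by rewrite /variance_function normrN. Qed.

(** Stationarity only speaks of laws, but a second moment is a function of the
    law; the variable [Y 0] disappears because it vanishes almost surely. *)
Lemma inner_increment s t : 0 <= s -> 0 <= t ->
  inner P (fun w => Y (t + s) w - Y s w) (fun w => Y (t + s) w - Y s w) =
  variance_function Y t.
Proof.
move=> s0 t0.
have -> : inner P (fun w => Y (t + s) w - Y s w) (fun w => Y (t + s) w - Y s w) =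
          inner P (fun w => Y t w - Y 0 w) (fun w => Y t w - Y 0 w).
  apply: (@eq_law_inner _ _ _ P (Y (t + s) \- Y s)%R (Y t \- Y 0)%R) => A mA.
  have := Y_stationary (n := 1) (t := fun=> t) (A := fun=> A) s0 (fun=> t0) (fun=> mA).
  have E (X : T -> R) : [set w | 'I_1 -> A (X w)] = X @^-1` A.
    by apply/seteqP; split => w /= => [/(_ ord0)|].
  by rewrite (E (fun w => Y (t + s) w - Y s w)) (E (fun w => Y t w - Y 0 w)).
rewrite variance_functionE// /inner /Rintegral; congr fine.
apply: ae_eq_integral => //; try by apply/measurable_EFinP/measurable_funM;
  try apply: measurable_funB.
by apply: filterS Y_0 => w Y0w _; rewrite /= Y0w !subr0.
Qed.

(** Polarization of the variance of the increment. *)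
Lemma inner_process s t : 0 <= s -> s <= t ->
  inner P (Y s) (Y t) =
  (variance_function Y s + variance_function Y t
   - variance_function Y (t - s)) / 2.
Proof.
move=> s0 st; have t0 := le_trans s0 st.
have ts0 : 0 <= t - s by rewrite subr_ge0.
have Ys := gaussian_process_Lfun2 s0; have Yt := gaussian_process_Lfun2 t0.
have := inner_increment s0 ts0; rewrite subrK => <-.
have Yts := Lfun2_sub Yt Ys.
rewrite inner_subl// !inner_subr// !variance_functionE// (innerC P (Y t) (Y s)).
by field.
Qed.

Variables (h : R) (Gamma : R -> R).
Hypothesis h_gt0 : 0 < h.
Hypothesis Gamma_cov : forall s t : R, 0 <= s -> 0 <= t ->
  'E_P[increment_process Y h s \* increment_process Y h t]%E = (Gamma (t - s))%:E.

Lemma increment_process_Lfun2 t : 0 <= t -> increment_process Y h t \in Lfun P 2%:E.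
Proof.
by move=> t0; apply: Lfun2_sub; apply: gaussian_process_Lfun2 => //;
  rewrite addr_ge0// ltW.
Qed.

Lemma Gamma_inner s t : 0 <= s -> 0 <= t ->
  Gamma (t - s) = inner P (increment_process Y h s) (increment_process Y h t).
Proof.
move=> s0 t0; apply: EFin_inj; rewrite -Gamma_cov// /inner /Rintegral fineK.
  by rewrite unlock.
apply: integrable_fin_num => //.
by apply: integrable_mul; exact: increment_process_Lfun2.
Qed.

Lemma Gamma_even t : Gamma (- t) = Gamma t.
Proof.
wlog t0 : t / 0 <= t => [H|].
  have [/H//|/ltW t0] := leP 0 t.
  by have := H (- t); rewrite opprK oppr_ge0 => /(_ t0).
rewrite -sub0r -[in RHS](subr0 t) (Gamma_inner t0 (lexx 0)).
by rewrite (Gamma_inner (lexx 0) t0) innerC.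
Qed.

(** The right-hand side is half of the second difference of the variance, which
    is an even function of [t]; for [0 <= t] it is obtained by expanding the
    covariance of the increments at times [0] and [t]. *)
Lemma Gamma_increment_function t :
  Gamma t = (increment_function Y h t - increment_function Y h (t - h)) / 2.
Proof.
have -> : increment_function Y h t - increment_function Y h (t - h) =
   variance_function Y (t + h) - 2 * variance_function Y t
   + variance_function Y (t - h).
  by rewrite /increment_function subrK; ring.
wlog t0 : t / 0 <= t => [H|].
  have [/H//|/ltW t0] := leP 0 t.
  rewrite -[in LHS](opprK t) Gamma_even H ?oppr_ge0//.
  rewrite -(variance_functionN (- t + h)) -(variance_functionN (- t - h)).
  rewrite (variance_functionN t) !opprD !opprK.
  by field.
have h0 := ltW h_gt0.
have th0 : 0 <= t + h by rewrite addr_ge0.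
have Yh := gaussian_process_Lfun2 h0; have Yt := gaussian_process_Lfun2 t0.
have Yth := gaussian_process_Lfun2 th0.
have Y00 := gaussian_process_Lfun2 (lexx 0).
have Vhs : variance_function Y (h - t) = variance_function Y (t - h).
  by rewrite -variance_functionN opprB.
have Yht : inner P (Y h) (Y t) = (variance_function Y h + variance_function Y t
    - variance_function Y (t - h)) / 2.
  have [ht|/ltW th] := leP h t; first exact: inner_process.
  by rewrite innerC inner_process// Vhs; ring.
rewrite -[in LHS](subr0 t) Gamma_inner// /increment_process add0r.
rewrite inner_subl ?inner_subr ?Lfun2_sub// Yht !inner_process ?lerDr// !subr0 addrK.
by field.
Qed.

(** The process has nonnegative times only, but the kernel is invariant under
    translation, so the points can be shifted to the right. *)
Lemma Gamma_psd : positive_semidefinite (fun s t => Gamma (t - s)).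
Proof.
move=> s; pose M := \sum_(p <- s) `|p.2|.
have shift p : p \in s -> 0 <= p.2 + M.
  move=> ps; rewrite /M (perm_big _ (perm_to_rem ps)) big_cons addrA.
  rewrite addr_ge0//; first by have := ler_norm (- p.2); rewrite normrN; lra.
  by rewrite sumr_ge0.
have := @gram_psd _ _ _ P (fun t => increment_process Y h (t + M)) s.
move=> /(_ (fun p ps => increment_process_Lfun2 (shift p ps))).
congr (_ <= _); rewrite !big_seq; apply: eq_bigr => p ps.
rewrite !big_seq; apply: eq_bigr => q qs.
by rewrite -Gamma_inner ?shift//; congr (_ * Gamma _); ring.
Qed.

End Process.

(** * Stationary positive semidefinite kernels *)

Definition uniformly_continuous (R : realType) (g : R -> R) : Prop :=
  forall e, 0 < e -> exists2 r, 0 < r &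
    forall x y, `|x - y| <= r -> `|g x - g y| <= e.

Section StationaryKernel.
Context (R : realType) (G : R -> R).
Hypothesis G_psd : positive_semidefinite (fun s t => G (t - s)).
Hypothesis G_even : forall t, G (- t) = G t.

Lemma psd_ge0 : 0 <= G 0.
Proof. by have := G_psd [:: (1, 0)]; rewrite !big_cons !big_nil /= subrr; lra. Qed.

Lemma psd_le0 p : G p <= G 0.
Proof.
have := G_psd [:: (1, 0); (- 1, p)].
by rewrite !big_cons !big_nil /= !subrr !subr0 !sub0r !G_even; lra.
Qed.

(** The weights [1], [c], [- c] at [u], [0], [p] give a polynomial of degree at
    most two in [c] that is nonnegative, so its discriminant is not positive. *)
Lemma psd_increment u p : (G u - G (u - p)) ^+ 2 <= 2 * G 0 * (G 0 - G p).
Proof.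
have H c : 0 <= G 0 + 2 * c * (G u - G (u - p)) + 2 * c ^+ 2 * (G 0 - G p).
  have := G_psd [:: (1, u); (c, 0); (- c, p)].
  rewrite !big_cons !big_nil /= !subrr !subr0 !sub0r !G_even -(G_even (p - u)) opprB.
  by congr (_ <= _); ring.
have a0 : 0 <= G 0 - G p by rewrite subr_ge0 psd_le0.
set b := G u - G (u - p) in H *; set a := G 0 - G p in H a0 *.
have [a_0|an0] := eqVneq a 0.
  rewrite a_0 mulr0; have [->|bn0] := eqVneq b 0; first by rewrite expr0n.
  (* The polynomial is affine; at this [c] it would take the value [- 1]. *)
  have := H (- (G 0 + 1) / (2 * b)); rewrite a_0 mulr0 addr0.
  have -> : 2 * (- (G 0 + 1) / (2 * b)) * b = - (G 0 + 1) by field.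
  by lra.
have := H (- b / (2 * a)).
have -> : G 0 + 2 * (- b / (2 * a)) * b + 2 * (- b / (2 * a)) ^+ 2 * a
  = (2 * G 0 * a - b ^+ 2) / (2 * a) by field.
by rewrite pmulr_lge0 ?subr_ge0// invr_gt0 mulr_gt0// lt_def an0.
Qed.

(** By the previous bound, continuity at the origin propagates uniformly. *)
Lemma psd_uniformly_continuous : {for 0, continuous G} -> uniformly_continuous G.
Proof.
move=> G0c e e0.
have G0 := psd_ge0.
(* The summand [1] keeps the denominator positive when [G 0 = 0]. *)
pose eta := e ^+ 2 / (2 * G 0 + 1).
have eta0 : 0 < eta by rewrite divr_gt0 ?exprn_gt0//; lra.
have /cvgrPdist_lt/(_ _ eta0)/nbhs_ballP[r /= r0 rG] := G0c.
exists (r / 2); first by rewrite divr_gt0.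
move=> x y xy; have : `|G 0 - G (x - y)| < eta.
  by apply: rG; rewrite /ball/= sub0r normrN; lra.
rewrite ger0_norm ?subr_ge0 ?psd_le0// => Gxy.
rewrite -(@ler_pXn2r _ 2)// ?nnegrE ?normr_ge0 ?(ltW e0)//.
rewrite real_normK ?num_real//.
have := psd_increment x (x - y); rewrite opprB addrCA subrr addr0 => /le_trans; apply.
apply: (@le_trans _ _ ((2 * G 0 + 1) * eta)).
  have := psd_le0 (x - y); nra.
by rewrite /eta mulrC divfK// gt_eqF//; lra.
Qed.

(** If the kernel returned to its maximum at some [p], the increment bound
    would make it [p]-periodic. *)
Lemma psd_lt0 p u : G (u + p) != G u -> G p < G 0.
Proof.
move=> Gup; rewrite lt_def psd_le0 andbT; apply: contra_neqN Gup => /eqP G0p.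
have := psd_increment (u + p) p; rewrite addrK G0p subrr mulr0.
by move=> sq_le0; apply/eqP; rewrite -subr_eq0 -sqrf_eq0 eq_le sq_le0 sqr_ge0.
Qed.

End StationaryKernel.

(** A function with equal values at the ends of an interval and with at most one
    critical point inside cannot reach its minimum inside: that minimum would be
    the critical point, hence also a local maximum, so the function would be
    constant around it and have further critical points. *)
Lemma gt_endpoints (R : realType) (g : R -> R) (h : R) :
  (forall t, derivable g t 1) -> g 0 = g h ->
  (forall t1 t2 : R, 0 < t1 < h -> 0 < t2 < h ->
     critical_point g t1 -> critical_point g t2 -> t1 = t2) ->
  (forall t : R, 0 < t < h -> critical_point g t -> local_max g t) ->
  forall t, 0 < t < h -> g 0 < g t.
Proof.
move=> dg g0h uniq_crit crit_max t t0h.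
have h0 : 0 < h by case/andP: t0h => /lt_trans; apply.
have gc : {within `[0, h], continuous g}.
  apply: continuous_subspaceT => x.
  by apply: differentiable_continuous; apply/derivable1_diffP; exact: dg.
have min_absurd m : 0 < m < h -> (forall s, s \in `[0, h]%R -> g m <= g s) -> False.
  move=> m0h gm; have [m0 mh] := andP m0h.
  have crit c : 0 < c < h -> g c = g m -> critical_point g c.
    move=> c0h gcm; apply: (@derive1_at_min _ g 0 h c (ltW h0)) => //.
    - by move=> s; rewrite in_itv/= => s0h; rewrite gcm gm// in_itv/=; lra.
  have /nbhs_ballP[r /= r0 rg] := crit_max m m0h (crit m m0h erefl).
  pose k := Num.min (r / 2) ((h - m) / 2).
  have k0 : 0 < k by rewrite lt_min !divr_gt0// subr_gt0.
  have kr : k <= r / 2 by rewrite ge_min lexx.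
  have kh : k <= (h - m) / 2 by rewrite ge_min lexx orbT.
  have mkI : 0 < m + k < h by lra.
  have gmk : g (m + k) = g m.
    apply/eqP; rewrite eq_le; apply/andP; split.
      by apply: rg; rewrite /ball/= opprD addNKr normrN gtr0_norm//; lra.
    by apply: gm; rewrite in_itv/=; lra.
  have := uniq_crit _ _ mkI m0h (crit _ mkI gmk) (crit m m0h erefl); lra.
have [m mI gm] := EVT_min (ltW h0) gc.
rewrite ltNge; apply/negP => gt.
have tI : t \in `[0, h]%R by rewrite in_itv/=; lra.
apply: (min_absurd t t0h) => s sI; apply: le_trans gt _.
apply: le_trans (gm s sI).
move: mI; rewrite in_itv/= => /andP[]; rewrite le_eqVlt => /predU1P[<-//|m0].
rewrite le_eqVlt => /predU1P[->|mh]; first by rewrite g0h.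
by case: (min_absurd m) => //; rewrite m0.
Qed.

(** Strict concavity on the positive half-line, in the form that compares two
    increments of the same length over disjoint intervals. *)
Lemma concave_increment (R : realType) (f : R -> R) (h p : R) :
  0 < h -> h <= p -> (forall t, derivable f t 1) ->
  (forall t, 0 < t -> derivable f^`() t 1 /\ f^`(2)%classic t < 0) ->
  f (p + h) - f p < f h - f 0.
Proof.
move=> h0 hp df d2f.
have cf a b : {within `[a, b], continuous f}.
  apply: continuous_subspaceT => x.
  by apply: differentiable_continuous; apply/derivable1_diffP; exact: df.
have isd (x : R) : is_derive x (1 : R) f (f^`() x) by rewrite derive1E; exact/derivableP.
have ph : p < p + h by rewrite ltrDl.
have [c1 + ->] := MVT h0 (fun x _ => isd x) (cf 0 h).
have [c2 + ->] := MVT ph (fun x _ => isd x) (cf p (p + h)).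
rewrite !in_itv/= => /andP[pc2 _] /andP[c10 c1h].
rewrite subr0 addrAC subrr add0r ltr_pM2r//.
have c12 : c1 < c2 by apply: lt_trans c1h _; exact: le_lt_trans hp pc2.
apply: (@ltr0_derive1_lt_cc _ f^`() c1 c2); rewrite ?in_itv/= ?lexx ?(ltW c12)//.
- move=> x; rewrite in_itv/= => /andP[c1x _].
  by apply: (d2f x _).1; exact: lt_trans c1x.
- move=> x; rewrite in_itv/= => /andP[c1x _].
  by apply: (d2f x _).2; exact: lt_trans c1x.
- apply: derivable_within_continuous => x; rewrite in_itv/= => /andP[c1x _].
  by apply: (d2f x _).1; exact: lt_le_trans c1x.
Qed.

(** * Double integrals of positive semidefinite kernels *)

Section Quadrature.
Context (R : realType) (mu : probability (measurableTypeR R) R) (a b : R).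
Implicit Types (A : set (measurableTypeR R)) (g : R -> R).

Lemma uniformly_continuous_continuous g : uniformly_continuous g -> continuous g.
Proof.
move=> gu x; apply/cvgrPdist_le => e e0; have [r r0 rg] := gu e e0.
by apply/nbhs_ballP; exists r => //= y /ltW xy; exact: rg.
Qed.

Lemma uniformly_continuous_integrable g A : uniformly_continuous g ->
  measurable A -> A `<=` `[a, b] -> mu.-integrable A (EFin \o g).
Proof.
move=> /uniformly_continuous_continuous gc mA Aab.
apply: measurable_bounded_integrable => //.
- by rewrite (le_lt_trans (probability_le1 mu mA))// ltry.
- have mg := continuous_measurable_fun gc.
  by apply: measurable_funTS; exact: mg.
- have [ab|ba] := leP a b; last first.
    exists 0; split => // M _ x /Aab; rewrite /= in_itv/= => /andP[ax xb].
    by have := le_trans ax xb; rewrite leNgt ba.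
  have gw : {within `[a, b], continuous g} by exact: continuous_subspaceT.
  have [M _ gM] := EVT_max ab gw; have [m _ gm] := EVT_min ab gw.
  exists (`|g M| + `|g m|); split; first exact: num_real.
  move=> x xM y /Aab yab; apply: le_trans (ltW xM).
  have := gM y yab; have := gm y yab.
  have := ler_norm (g M); have := ler_norm (- g m); rewrite normrN.
  have := normr_ge0 (g M); have := normr_ge0 (g m).
  by rewrite ler_norml; lra.
Qed.

Lemma prob_ge0 A : 0 <= fine (mu A). Proof. by rewrite fine_ge0. Qed.

Lemma prob_setU A B : measurable A -> measurable B -> [disjoint A & B] ->
  fine (mu (A `|` B)) = fine (mu A) + fine (mu B).
Proof.
move=> mA mB AB; rewrite measureU//; last exact/disj_set2P.
by rewrite fineD// fin_num_measure.
Qed.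

(** The measure is discretized on finitely many cells of diameter at most [r],
    the mass of each cell being moved to the left end of the cell. *)
Lemma cell_quadrature (r : R) (n : nat) : 0 < r ->
  let D : set R := `[a, b]%classic `&` `]-oo, (a + r *+ n)[%classic in
  exists s : seq (R * R), [/\ (forall p, p \in s -> 0 <= p.1),
    \sum_(p <- s) p.1 = fine (mu D) &
    forall g e, uniformly_continuous g ->
      (forall x y, `|x - y| <= r -> `|g x - g y| <= e) ->
      `|\int[mu]_(x in D) g x - \sum_(p <- s) p.1 * g p.2| <= e * fine (mu D)].
Proof.
move=> r0; elim: n => [|n [s [s0 smass sint]]] /=.
  have -> : `[a, b] `&` `]-oo, (a + r *+ 0)[%classic = set0.
    apply/seteqP; split => x //=; rewrite mulr0n addr0 !in_itv/= => -[/andP[ax _]].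
    by rewrite ltNge ax.
  exists [::]; split => //; first by rewrite big_nil measure0.
  by move=> g e _ _; rewrite big_nil Rintegral_set0 measure0 subrr normr0 mulr0.
set D := `[a, b] `&` _ in smass sint *; set D' := `[a, b] `&` _.
pose x_ := a + r *+ n.
pose A : set (measurableTypeR R) := `[a, b] `&` `[x_, x_ + r[.
have mitv (i : interval R) : measurable ([set` i] : set (measurableTypeR R)).
  exact: measurable_itv.
have mD : measurable D by exact: measurableI.
have mA : measurable A by exact: measurableI.
have DA : D' = D `|` A.
  apply/seteqP; split => x; rewrite /D' /D /A /x_ /= mulrS !in_itv/=.
    move=> [xab xlt]; have [xl|lx] := ltP x (a + r *+ n); first by left.
    by right; split => //; lra.
  by move=> [[xab xlt]|[xab xlt]]; split => //; lra.
have DA0 : [disjoint D & A].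
  apply/disj_set2P; apply/seteqP; split => x //=; rewrite /D /A /= !in_itv/=.
  by move=> [[_ xlt] [_ /andP[lx _]]]; move: lx; rewrite leNgt xlt.
exists ((fine (mu A), x_) :: s); split.
- move=> p; rewrite inE => /predU1P[->|/s0//]; exact: prob_ge0.
- by rewrite big_cons /= smass DA prob_setU// addrC.
- move=> g e gu ge; rewrite big_cons /= DA prob_setU//.
  have iDA : mu.-integrable (D `|` A) (EFin \o g).
    apply: uniformly_continuous_integrable => //; first exact: measurableU.
    by move=> x [[]|[]].
  rewrite Rintegral_setU//.
  have iA : mu.-integrable A (EFin \o g).
    by apply: uniformly_continuous_integrable => // x [].
  have icst (c : R) : mu.-integrable A (EFin \o cst c).
    exact: finite_measure_integrable_cst.
  have gA : `|\int[mu]_(x in A) g x - fine (mu A) * g x_| <= e * fine (mu A).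
    have -> : fine (mu A) * g x_ = \int[mu]_(x in A) cst (g x_) x.
      by rewrite Rintegral_cst// mulrC.
    rewrite -RintegralB//.
    have iB := integrableB mA iA (icst (g x_)).
    apply: (le_trans (le_normr_Rintegral _ _)) => //.
    rewrite -Rintegral_cst//; apply: le_Rintegral => //.
    + exact: (integrable_norm iB).
    + exact: icst.
    + move=> x; rewrite /A /= !in_itv/= => -[_ /andP[x1 x2]]; apply: ge.
      by rewrite ger0_norm; lra.
  have := sint g e gu ge; move: gA; rewrite mulrDr.
  set I1 := Rintegral _ _ _; set I2 := Rintegral _ _ _; set S := \sum_(_ <- _) _.
  move=> gA gD.
  have -> : I2 + I1 - (fine (mu A) * g x_ + S) =
            (I2 - S) + (I1 - fine (mu A) * g x_) by ring.
  by rewrite (le_trans (ler_normD _ _))// lerD.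
Qed.

Hypothesis mu_ab : M1 a b mu.

Lemma quadrature (r : R) : 0 < r ->
  exists s : seq (R * R), [/\ (forall p, p \in s -> 0 <= p.1),
    \sum_(p <- s) p.1 = 1 &
    forall g e, uniformly_continuous g ->
      (forall x y, `|x - y| <= r -> `|g x - g y| <= e) ->
      `|\int[mu]_(x in `[a, b]) g x - \sum_(p <- s) p.1 * g p.2| <= e].
Proof.
move=> r0; pose n := (Num.truncn ((b - a) / r)).+1.
have bn : b < a + r *+ n.
  have : (b - a) / r < n%:R by exact: truncnS_gt.
  by rewrite ltr_pdivrMr// mulr_natl; lra.
have [s] := cell_quadrature n r0.
have -> : `[a, b] `&` `]-oo, (a + r *+ n)[%classic = `[a, b].
  apply/seteqP; split => x /=; first by case.
  by rewrite !in_itv/= => /andP[ax xb]; split; lra.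
have -> : fine (mu `[a, b]) = 1 by rewrite mu_ab.
move=> [s0 s1 sint]; exists s; split => // g e gu ge.
by have := sint g e gu ge; rewrite mulr1.
Qed.

End Quadrature.

Section Potential.
Context (R : realType) (mu : probability (measurableTypeR R) R) (a b : R).
Hypothesis mu_ab : M1 a b mu.
Implicit Types (g : R -> R) (K : R -> R -> R).

Let itv_measurable : measurable (`[a, b]%classic : set (measurableTypeR R)).
Proof. exact: measurable_itv. Qed.

Lemma Rintegral_cst_prob (c : R) : \int[mu]_(x in `[a, b]) c = c.
Proof.
rewrite Rintegral_cst// -[RHS]mulr1; congr (_ * _).
by rewrite -[RHS]/(fine 1%E); congr fine; exact: mu_ab.
Qed.

Lemma integrable_on_itv g : uniformly_continuous g ->
  mu.-integrable `[a, b] (EFin \o g).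
Proof.
move=> gu; exact: (uniformly_continuous_integrable _ gu itv_measurable (@subset_refl _ _)).
Qed.

Lemma le_Rintegral_itv g1 g2 :
  uniformly_continuous g1 -> uniformly_continuous g2 ->
  (forall x, x \in `[a, b]%R -> g1 x <= g2 x) ->
  \int[mu]_(x in `[a, b]) g1 x <= \int[mu]_(x in `[a, b]) g2 x.
Proof. by move=> u1 u2 g12; apply: le_Rintegral => //; exact: integrable_on_itv. Qed.

Lemma uniformly_continuous_cst (c : R) : uniformly_continuous (fun _ : R => c).
Proof. by move=> e e0; exists 1 => // x y _; rewrite subrr normr0 ltW. Qed.

Lemma uniformly_continuous_lin (c : R) g1 g2 : uniformly_continuous g1 ->
  uniformly_continuous g2 -> uniformly_continuous (fun x => c * g1 x + g2 x).
Proof.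
move=> u1 u2 e e0.
have c0 : 0 < `|c| + 1 by rewrite ltr_wpDl.
have [r1 r10 H1] := u1 (e / 2 / (`|c| + 1)) ltac:(by rewrite !divr_gt0).
have [r2 r20 H2] := u2 (e / 2) ltac:(by rewrite divr_gt0).
exists (Num.min r1 r2); first by rewrite lt_min r10.
move=> x y; rewrite le_min => /andP[/H1 xy1 /H2 xy2].
have -> : c * g1 x + g2 x - (c * g1 y + g2 y) =
   c * (g1 x - g1 y) + (g2 x - g2 y) by ring.
rewrite (le_trans (ler_normD _ _))// (splitr e) lerD// normrM.
apply: (@le_trans _ _ ((`|c| + 1) * (e / 2 / (`|c| + 1)))).
  by rewrite ler_pM// lerDl.
by rewrite mulrC divfK// gt_eqF.
Qed.

Lemma uniformly_continuous_shift (c : R) g : uniformly_continuous g ->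
  uniformly_continuous (fun x => g (x - c)).
Proof.
move=> gu e e0; have [r r0 H] := gu e e0; exists r => // x y xy.
by apply: H; rewrite opprB addrA subrK.
Qed.

Lemma uniformly_continuous_reflect (c : R) g : uniformly_continuous g ->
  uniformly_continuous (fun x => g (c - x)).
Proof.
move=> gu e e0; have [r r0 H] := gu e e0; exists r => // x y xy.
apply: H; have -> : c - x - (c - y) = y - x by ring.
by rewrite distrC.
Qed.

Lemma potential_uniformly_continuous K :
  (forall t, uniformly_continuous (K^~ t)) ->
  (forall e, 0 < e -> exists2 r, 0 < r &
    forall x y s, `|x - y| <= r -> `|K s x - K s y| <= e) ->
  uniformly_continuous (fun t => \int[mu]_(s in `[a, b]) K s t).
Proof.
move=> Ku Kr e e0; have [r r0 H] := Kr e e0; exists r => // x y xy.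
have le1 u v : `|u - v| <= r ->
    \int[mu]_(s in `[a, b]) K s u <= \int[mu]_(s in `[a, b]) K s v + e.
  move=> uv; rewrite -[X in _ + X]Rintegral_cst_prob -RintegralD//; first last.
  - exact: (integrable_on_itv (@uniformly_continuous_cst e)).
  - exact: (integrable_on_itv (Ku v)).
  apply: le_Rintegral_itv => //.
    have := uniformly_continuous_lin 1 (Ku v) (@uniformly_continuous_cst e).
    by under eq_fun do rewrite mul1r.
  move=> s _; have := H u v s uv; rewrite ler_norml => /andP[_].
  by rewrite lerBlDl addrC.
have := le1 x y xy; have := le1 y x; rewrite distrC => /(_ xy).
by rewrite ler_norml; lra.
Qed.

(** The quadrature turns the double integral into a quadratic form with
    nonnegative value, up to an error [e / 2] for each of the two integrals. *)
Lemma double_integral_ge0 K : (forall s t, K s t = K t s) ->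
  positive_semidefinite K ->
  (forall e, 0 < e -> exists2 r, 0 < r &
    forall x y s, `|x - y| <= r -> `|K s x - K s y| <= e) ->
  0 <= \int[mu]_(t in `[a, b]) \int[mu]_(s in `[a, b]) K s t.
Proof.
move=> K_sym K_psd K_uc.
have Ku t : uniformly_continuous (K^~ t).
  move=> e e0; have [r r0 H] := K_uc e e0; exists r => // x y xy.
  by rewrite !(K_sym _ t); exact: H.
have Uu := potential_uniformly_continuous Ku K_uc.
apply/ler_addgt0Pr => e e0.
have e20 : 0 < e / 2 by rewrite divr_gt0.
have [r1 r10 H1] := K_uc _ e20; have [r2 r20 H2] := Uu _ e20.
have r0 : 0 < Num.min r1 r2 by rewrite lt_min r10.
have [s [s0 s1 sint]] := quadrature mu_ab r0.
have := sint _ (e / 2) Uu.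
have E2 x y : `|x - y| <= Num.min r1 r2 ->
    `|\int[mu]_(s in `[a, b]) K s x - \int[mu]_(s in `[a, b]) K s y| <= e / 2.
  by rewrite le_min => /andP[_]; exact: H2.
move=> /(_ E2); set I := Rintegral _ _ _; set S := \sum_(_ <- _) _ => IS.
have le_S : \sum_(q <- s) q.1 * (\sum_(p <- s) p.1 * K p.2 q.2 - e / 2) <= S.
  rewrite /S big_seq [leRHS]big_seq; apply: ler_sum => q qs.
  rewrite ler_wpM2l ?s0//.
  have E1 x y : `|x - y| <= Num.min r1 r2 -> `|K x q.2 - K y q.2| <= e / 2.
    by rewrite le_min => /andP[xy _]; rewrite !(K_sym _ q.2); exact: H1.
  by have := sint _ _ (Ku q.2) E1; rewrite ler_norml; lra.
have sumE : \sum_(q <- s) q.1 * (\sum_(p <- s) p.1 * K p.2 q.2 - e / 2) =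
   \sum_(q <- s) \sum_(p <- s) q.1 * p.1 * K q.2 p.2 - e / 2.
  under eq_bigr do rewrite mulrBr.
  rewrite sumrB -mulr_suml s1 mul1r; congr (_ - _).
  apply: eq_bigr => q _; rewrite mulr_sumr; apply: eq_bigr => p _.
  by rewrite mulrA K_sym.
have := K_psd s; move: le_S IS; rewrite sumE ler_norml; lra.
Qed.

End Potential.

(** * Comparison with a finitely supported measure *)

Section Energy.
Context (R : realType) (G : R -> R).
Hypothesis G_psd : positive_semidefinite (fun s t => G (t - s)).
Hypothesis G_even : forall t, G (- t) = G t.
Hypothesis G_uc : uniformly_continuous G.

Definition discrete_potential (m : seq (R * R)) (t : R) : R :=
  \sum_(p <- m) p.1 * G (t - p.2).

Definition discrete_energy (m : seq (R * R)) : R :=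
  \sum_(p <- m) p.1 * discrete_potential m p.2.

Lemma discrete_potential_uc m : uniformly_continuous (discrete_potential m).
Proof.
elim: m => [|p m IH].
  rewrite (_ : discrete_potential _ = fun=> 0); last first.
    by apply/funext => t; rewrite /discrete_potential big_nil.
  exact: uniformly_continuous_cst.
rewrite (_ : discrete_potential _ =
    fun t => p.1 * G (t - p.2) + discrete_potential m t); last first.
  by apply/funext => t; rewrite /discrete_potential big_cons.
by apply: uniformly_continuous_lin => //; exact: uniformly_continuous_shift.
Qed.

(** The covariance kernel of the process once its average against the discrete
    measure [m] has been subtracted. *)
Definition centered_kernel m s t : R :=
  G (t - s) - discrete_potential m s - discrete_potential m t
  + discrete_energy m.

(** Evaluating the centered kernel on weighted points of total weight [W] amounts
    to evaluating [G] on these points together with [m] scaled by [- W]. *)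
Lemma centered_kernel_psd m : positive_semidefinite (centered_kernel m).
Proof.
move=> s; pose W := \sum_(p <- s) p.1.
have := G_psd (s ++ [seq (- W * p.1, p.2) | p <- m]).
pose S1 := \sum_(p <- s) p.1 * discrete_potential m p.2.
congr (_ <= _); rewrite big_cat /= big_map /=.
under eq_bigr do rewrite big_cat big_map/=.
under [X in _ + X]eq_bigr do rewrite big_cat big_map/=.
rewrite !big_split /=.
have -> : \sum_(p <- s) \sum_(q <- m) p.1 * (- W * q.1) * G (q.2 - p.2) = - W * S1.
  rewrite /S1 mulr_sumr; apply: eq_bigr => p _.
  rewrite /discrete_potential !mulr_sumr; apply: eq_bigr => q _.
  by rewrite -(G_even (q.2 - p.2)) opprB; ring.
have -> : \sum_(q <- m) \sum_(p <- s) - W * q.1 * p.1 * G (p.2 - q.2) = - W * S1.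
  rewrite exchange_big /S1 mulr_sumr; apply: eq_bigr => p _ /=.
  rewrite /discrete_potential !mulr_sumr; apply: eq_bigr => q _.
  by ring.
have -> : \sum_(q <- m) \sum_(q' <- m) - W * q.1 * (- W * q'.1) * G (q'.2 - q.2)
    = W ^+ 2 * discrete_energy m.
  rewrite mulr_sumr; apply: eq_bigr => q _.
  rewrite /discrete_potential !mulr_sumr; apply: eq_bigr => q' _.
  by rewrite -(G_even (q'.2 - q.2)) opprB; ring.
under [RHS]eq_bigr => p _.
  under eq_bigr => q _ do rewrite /centered_kernel mulrDr !mulrBr.
  rewrite big_split /= !sumrB.
  rewrite -[X in _ - X - _ + _]mulr_suml -[X in _ + X]mulr_suml -!mulr_sumr -/W.
  under [X in _ - _ - X + _]eq_bigr do rewrite -mulrA.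
  rewrite -[X in _ - _ - X + _]mulr_sumr -/S1.
  over.
rewrite big_split /= !sumrB -!mulr_suml -/W.
under [X in _ = _ - X - _ + _]eq_bigr do rewrite mulrAC.
by rewrite -mulr_suml -/S1; ring.
Qed.

Context (mu : probability (measurableTypeR R) R) (a b : R).
Hypothesis mu_ab : M1 a b mu.

Definition real_energy : R :=
  \int[mu]_(t in `[a, b]) \int[mu]_(s in `[a, b]) G (t - s).

Lemma potential_uc :
  uniformly_continuous (fun t => \int[mu]_(s in `[a, b]) G (t - s)).
Proof.
apply: (potential_uniformly_continuous mu_ab) => [t|e e0].
  exact: uniformly_continuous_reflect.
have [r r0 H] := G_uc e0; exists r => // x y s xy; apply: H.
by rewrite opprB addrA subrK.
Qed.

Lemma energyE : energy (fun s t => G (t - s)) a b mu = real_energy%:E.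
Proof.
have mab : measurable (`[a, b]%classic : set (measurableTypeR R)).
  exact: measurable_itv.
have fineI g : uniformly_continuous g ->
    (\int[mu]_(t in `[a, b]) (g t)%:E = (\int[mu]_(t in `[a, b]) g t)%:E)%E.
  move=> gu; rewrite /Rintegral fineK//; exact: (integrable_fin_num mab (integrable_on_itv mu a b gu)).
rewrite /energy; under eq_integral => t _.
  rewrite fineI; first over.
  exact: uniformly_continuous_reflect.
by rewrite fineI//; exact: potential_uc.
Qed.

(** The difference of the two sides is the energy of [mu - m], that is, the double
    integral of the centered kernel. *)
Lemma real_energy_ge m :
  2 * \int[mu]_(t in `[a, b]) discrete_potential m t - discrete_energy m
  <= real_energy.
Proof.
have Uu := discrete_potential_uc m.
have mab : measurable (`[a, b]%classic : set (measurableTypeR R)).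
  exact: measurable_itv.
have iU := integrable_on_itv mu a b Uu.
have icst (c : R) : mu.-integrable `[a, b] (EFin \o cst c).
  exact: finite_measure_integrable_cst.
pose IU := \int[mu]_(t in `[a, b]) discrete_potential m t.
have : 0 <= \int[mu]_(t in `[a, b]) \int[mu]_(s in `[a, b]) centered_kernel m s t.
  apply: (double_integral_ge0 mu_ab).
  - by move=> s t; rewrite /centered_kernel -(G_even (t - s)) opprB; ring.
  - exact: centered_kernel_psd.
  - move=> e e0; have e20 : 0 < e / 2 by rewrite divr_gt0.
    have [r1 r10 H1] := G_uc e20; have [r2 r20 H2] := Uu _ e20.
    exists (Num.min r1 r2); first by rewrite lt_min r10.
    move=> x y s; rewrite le_min => /andP[xy1 xy2].
    have -> : centered_kernel m s x - centered_kernel m s y =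
       (G (x - s) - G (y - s)) + (discrete_potential m y - discrete_potential m x).
      by rewrite /centered_kernel; ring.
    rewrite (le_trans (ler_normD _ _))// (splitr e) lerD//.
      by apply: H1; rewrite opprB addrA subrK.
    by rewrite distrC; exact: H2.
have inner t : \int[mu]_(s in `[a, b]) centered_kernel m s t =
    \int[mu]_(s in `[a, b]) G (t - s)
    - (discrete_potential m t + (IU - discrete_energy m)).
  have iG : mu.-integrable `[a, b] (EFin \o (fun s => G (t - s))).
    by apply: integrable_on_itv; exact: uniformly_continuous_reflect.
  have -> : (fun s => centered_kernel m s t) = (fun s =>
      G (t - s) - discrete_potential m s
      - (discrete_potential m t - discrete_energy m)).
    by apply/funext => s; rewrite /centered_kernel; ring.
  rewrite (RintegralB mab (integrableB mab iG iU) (icst _)).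
  rewrite (RintegralB mab iG iU) Rintegral_cst_prob// -/IU.
  have key (x y z w : R) : x - y - (z - w) = x - (z + (y - w)) by ring.
  exact: key.
under eq_Rintegral do rewrite inner.
have iP := integrable_on_itv mu a b potential_uc.
rewrite (RintegralB mab iP (integrableD mab iU (icst (IU - discrete_energy m)))).
rewrite (RintegralD mab iU (icst _)).
rewrite Rintegral_cst_prob// -/IU -/real_energy; lra.
Qed.

End Energy.

(** * Measures carried by three points *)

Section ThreePoints.
Context (R : realType) (mu : probability (measurableTypeR R) R) (a b : R).
Hypothesis mu_ab : M1 a b mu.
Context (x1 x2 x3 : R).
Hypotheses (x12 : x1 != x2) (x13 : x1 != x3) (x23 : x2 != x3).

Let mass (x : R) : R := fine (mu [set x]).
Let S : set (measurableTypeR R) := [set x1] `|` ([set x2] `|` [set x3]).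
Hypothesis mu_S : mu S = 1%E.

Let m1 (x : R) : measurable ([set x] : set (measurableTypeR R)).
Proof. exact: measurable_set1. Qed.

Let mS : measurable S.
Proof. by apply: measurableU => //; exact: measurableU. Qed.

Let disj1 : [disjoint [set x1] & [set x2] `|` [set x3]].
Proof.
apply/disj_set2P; apply/seteqP; split => x //= -[-> []] /eqP.
  by rewrite (negbTE x12).
by rewrite (negbTE x13).
Qed.

Let disj2 : [disjoint [set x2] & [set x3]].
Proof.
by apply/disj_set2P; apply/seteqP; split => x //= -[-> /eqP]; rewrite (negbTE x23).
Qed.

Lemma three_masses : mass x1 + mass x2 + mass x3 = 1.
Proof.
have := congr1 fine mu_S; rewrite prob_setU// ?prob_setU ?addrA//.
exact: measurableU.
Qed.

Lemma three_points_measure (A : set (measurableTypeR R)) : measurable A ->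
  mu A = (mass x1 * (x1 \in A)%:R + mass x2 * (x2 \in A)%:R
          + mass x3 * (x3 \in A)%:R)%:E.
Proof.
move=> mA; have AS0 : mu (A `\` S) = 0%E.
  apply/eqP; rewrite -measure_le0.
  have <- : mu (~` S) = 0%E by rewrite probability_setC// mu_S subee.
  by apply: le_measure; rewrite ?inE//; [exact: measurableD|exact: measurableC].
have mAI (B : set (measurableTypeR R)) : measurable B -> measurable (A `&` B).
  exact: measurableI.
have single x : fine (mu (A `&` [set x])) = mass x * (x \in A)%:R.
  have [xA|xA] := boolP (x \in A).
    rewrite mulr1 (setIidr _)// => y ->; exact: set_mem.
  rewrite mulr0 (_ : A `&` [set x] = set0) ?measure0//.
  apply/seteqP; split => y //= -[Ay yx]; move: xA; rewrite -yx.
  by rewrite (mem_set Ay).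
have dI (B C : set (measurableTypeR R)) : [disjoint B & C] ->
    [disjoint A `&` B & A `&` C].
  move=> /disj_set2P BC; apply/disj_set2P.
  by rewrite setIACA BC setI0.
have -> : mu A = mu (A `&` S).
  transitivity (mu (A `\` S) + mu (A `&` S))%E; first exact: measureDI.
  by rewrite AS0 add0e.
rewrite -[LHS]fineK; last by apply: fin_num_measure; exact: mAI.
congr EFin; rewrite /S !setIUr prob_setU ?prob_setU ?single ?addrA//.
- exact: mAI.
- exact: mAI.
- exact: dI.
- exact: mAI.
- by apply: measurableU; exact: mAI.
- by rewrite -setIUr; exact: dI.
Qed.

Lemma three_points_integral (g : R -> R) : uniformly_continuous g ->
  {subset [:: x1; x2; x3] <= `[a, b]%R} ->
  \int[mu]_(x in `[a, b]) g x =
  mass x1 * g x1 + mass x2 * g x2 + mass x3 * g x3.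
Proof.
move=> gu xab.
have SD : S `<=` `[a, b].
  by move=> x [->|[->|->]]; apply: xab; rewrite !inE eqxx ?orbT.
have mD : measurable (`[a, b]%classic : set (measurableTypeR R)).
  exact: measurable_itv.
have mDS : measurable (`[a, b] `\` S : set (measurableTypeR R)).
  exact: measurableD.
have iD := integrable_on_itv mu a b gu.
have DS0 : mu (`[a, b] `\` S) = 0%E.
  apply/eqP; rewrite -measure_le0.
  have <- : mu (~` S) = 0%E by rewrite probability_setC// mu_S subee.
  by apply: le_measure; rewrite ?inE//; exact: measurableC.
have -> : \int[mu]_(x in `[a, b]) g x = \int[mu]_(x in S) g x.
  rewrite /Rintegral (@negligible_integral _ (measurableTypeR R) _ _ _ _ _ mDS mD iD DS0).
  by rewrite setDD (setIidr SD).
have iS := integrableS mD mS SD iD.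
have single x : \int[mu]_(y in [set x]) g y = mass x * g x.
  rewrite (@eq_Rintegral _ _ _ _ _ (cst (g x))).
    by rewrite Rintegral_cst// mulrC.
  by move=> y; rewrite inE => ->.
rewrite Rintegral_setU//; last exact: measurableU.
rewrite Rintegral_setU// ?single ?addrA//.
by apply: integrableS iS => //; [exact: measurableU|move=> x; right].
Qed.

End ThreePoints.

Lemma mnormalizeE d (T : measurableType d) (R : realType)
    (nu : {measure set T -> \bar R}) (P : probability T R) (c : R) :
  0 < c -> nu setT = c%:E ->
  forall A, mnormalize nu P A = (nu A * c^-1%:E)%E.
Proof.
by move=> c0 nuT A; rewrite /mnormalize nuT eqe gt_eqF.
Qed.

Lemma mu_star_probability (R : realType) (C a h b : R) : 0 < C ->
  exists mu : probability (measurableTypeR R) R,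
    forall A : set (measurableTypeR R), mu A = mu_star C a h b A.
Proof.
move=> C0; pose dirac_ x := @dirac _ (measurableTypeR R) x R.
pose nu1 : {measure set (measurableTypeR R) -> \bar R} :=
  measure_add (dirac_ a) (mscale (NngNum (ltW C0)) (dirac_ (a + h))).
pose nu : {measure set (measurableTypeR R) -> \bar R} :=
  measure_add nu1 (dirac_ b).
have nuE A : nu A = (\d_a A + C%:E * \d_(a + h)%R A + \d_b A)%E.
  have nu1E : nu1 A = (\d_a A + C%:E * \d_(a + h)%R A)%E by exact: measure_addE.
  by rewrite -nu1E; exact: measure_addE.
have nuT : nu setT = (2 + C)%:E.
  by rewrite nuE !diracT mule1 -!EFinD; congr EFin; ring.
exists (mnormalize nu (dirac_ a)) => A.
have -> : mu_star C a h b A = (nu A * (2 + C)^-1%:E)%E by rewrite nuE muleC.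
by apply: mnormalizeE nuT A; rewrite addr_gt0.
Qed.

(** * The optimal measure of a stationary kernel *)

Section Optimal.
Context (R : realType) (G : R -> R) (h a b : R).
Hypothesis G_psd : positive_semidefinite (fun s t => G (t - s)).
Hypothesis G_even : forall t, G (- t) = G t.
Hypothesis G_uc : uniformly_continuous G.
Hypothesis h_gt0 : 0 < h.
Hypothesis ab_2h : b - a = 2 * h.
Let C := Cstar G h.
Hypothesis C_gt0 : 0 < C.
Hypothesis Gh : G h < G 0.
Hypothesis G2h : G (2 * h) < G 0.
Hypothesis gamma_gt : forall t, 0 < t < h ->
  gamma_function G h 0 < gamma_function G h t.

Let w := (2 + C)^-1.
Let m : seq (R * R) := [:: (w, a); (w * C, a + h); (w, b)].
Let level := w * gamma_function G h 0.

Let C2_gt0 : 0 < 2 + C. Proof. by rewrite addr_gt0. Qed.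
Let w_gt0 : 0 < w. Proof. by rewrite invr_gt0. Qed.
Let bE : b = a + 2 * h. Proof. by rewrite -ab_2h addrC subrK. Qed.

Let CE : C * (G 0 - G h) = G 0 - 2 * G h + G (2 * h).
Proof. by rewrite /C /Cstar; field; rewrite subr_eq0 lt_eqF. Qed.

Lemma gamma_function0h : gamma_function G h h = gamma_function G h 0.
Proof.
have hh : 2 * h - h = h by ring.
rewrite /gamma_function !subr0 subrr hh -/C; have := CE; lra.
Qed.

(* With [b = a + 2 h] and the evenness of [G], the three terms of the potential
   are those of [gamma_function]. *)
Let potentialE x : discrete_potential G m (a + x) = w * gamma_function G h x.
Proof.
rewrite /discrete_potential /m !big_cons big_nil /= addr0 /gamma_function bE.
rewrite -(G_even (h - x)) -(G_even (2 * h - x)) -/C.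
have -> : a + x - a = x by ring.
have -> : a + x - (a + h) = - (h - x) by ring.
have -> : a + x - (a + 2 * h) = - (2 * h - x) by ring.
by ring.
Qed.

Let gamma_sym x : gamma_function G h (2 * h - x) = gamma_function G h x.
Proof.
rewrite /gamma_function -(G_even (h - x)).
have -> : h - (2 * h - x) = - (h - x) by ring.
by rewrite subKr; ring.
Qed.

Let potential_a : discrete_potential G m a = level.
Proof. by rewrite -[a in LHS]addr0 potentialE. Qed.

Let potential_ah : discrete_potential G m (a + h) = level.
Proof. by rewrite potentialE gamma_function0h. Qed.

Let potential_b : discrete_potential G m b = level.
Proof. by rewrite bE potentialE -[2 * h]subr0 gamma_sym. Qed.

Let energy_m : discrete_energy G m = level.
Proof.
rewrite /discrete_energy {1}/m !big_cons big_nil /= potential_a potential_ah.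
rewrite potential_b addr0 -!mulrDl (_ : _ + _ = 1) ?mul1r//.
by rewrite /w; field; rewrite gt_eqF.
Qed.

Lemma potential_gt x : x \in `[a, b]%R -> x != a -> x != a + h -> x != b ->
  level < discrete_potential G m x.
Proof.
rewrite in_itv/= => /andP[ax xb] xa xah xnb.
have ax' : a < x by rewrite lt_def xa.
have xb' : x < b by rewrite lt_def eq_sym xnb.
have -> : x = a + (x - a) by ring.
rewrite potentialE ltr_pM2l//.
have [xh|hx|xh] := ltgtP x (a + h).
- by apply: gamma_gt; rewrite bE in xb'; lra.
- by rewrite -(gamma_sym (x - a)); apply: gamma_gt; rewrite bE in xb'; lra.
- by rewrite xh eqxx in xah.
Qed.

Lemma potential_ge x : x \in `[a, b]%R -> level <= discrete_potential G m x.
Proof.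
move=> xab; have [->|xa] := eqVneq x a; first by rewrite potential_a.
have [->|xah] := eqVneq x (a + h); first by rewrite potential_ah.
have [->|xb] := eqVneq x b; first by rewrite potential_b.
exact/ltW/potential_gt.
Qed.

Let pts (mu : probability (measurableTypeR R) R) : Prop :=
  mu ([set a] `|` ([set a + h] `|` [set b])) = 1%E.

Let points_neq : [/\ a != a + h, a != b & a + h != b].
Proof.
have h0 := h_gt0; have [ah ab hb] : [/\ a < a + h, a < b & a + h < b] by rewrite bE; split; lra.
by rewrite !lt_eqF.
Qed.

Let points_in : {subset [:: a; a + h; b] <= `[a, b]%R}.
Proof.
have h0 := h_gt0; move=> x.
by rewrite in_itv/= !inE => /or3P[] /eqP ->; rewrite bE; apply/andP; split; lra.
Qed.

Lemma real_energy_three_points (mu : probability (measurableTypeR R) R) :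
  M1 a b mu -> pts mu ->
  let p := fine (mu [set a]) in let q := fine (mu [set a + h]) in
  let r := fine (mu [set b]) in
  p + q + r = 1 /\
  real_energy G mu a b = G 0 * (p ^+ 2 + q ^+ 2 + r ^+ 2)
    + 2 * G h * (p * q + q * r) + 2 * G (2 * h) * (p * r).
Proof.
move=> mu_ab mu3 p q r; have [n1 n2 n3] := points_neq.
split; first exact: three_masses mu3.
have int3 g : uniformly_continuous g ->
    \int[mu]_(x in `[a, b]) g x = p * g a + q * g (a + h) + r * g b.
  by move=> gu; exact: three_points_integral.
rewrite /real_energy int3; last exact: potential_uc.
rewrite !int3; try exact: uniformly_continuous_reflect.
rewrite !subrr -(G_even (a - (a + h))) -(G_even (a - b)) -(G_even (a + h - b)).
rewrite !opprB bE.
have -> : a + h - a = h by ring.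
have -> : a + 2 * h - a = 2 * h by ring.
have -> : a + 2 * h - (a + h) = h by ring.
by ring.
Qed.

Lemma real_energy_ge_level (mu : probability (measurableTypeR R) R) :
  M1 a b mu -> level <= real_energy G mu a b.
Proof.
move=> mu_ab.
have := real_energy_ge G_psd G_even G_uc mu_ab m; rewrite energy_m.
have := le_Rintegral_itv mu (uniformly_continuous_cst level)
  (discrete_potential_uc G_uc m) potential_ge.
by rewrite Rintegral_cst_prob//; lra.
Qed.

Lemma real_energy_mu_star (mu : probability (measurableTypeR R) R) :
  (forall A : set (measurableTypeR R), measurable A -> mu A = mu_star C a h b A) ->
  M1 a b mu /\ real_energy G mu a b = level.
Proof.
move=> muE; have [n1 n2 n3] := points_neq.
have w2C : w * (2 + C) = 1 by rewrite mulVf// gt_eqF.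
have val (A : set (measurableTypeR R)) : measurable A ->
    mu A = (w * ((a \in A)%:R + C * (a + h \in A)%:R + (b \in A)%:R))%:E.
  by move=> mA; rewrite muE// /mu_star !diracE -EFinM -!EFinD -EFinM.
have m1 x : measurable ([set x] : set (measurableTypeR R)).
  exact: measurable_set1.
have mu_ab : M1 a b mu.
  rewrite /M1 /= val; last exact: measurable_itv.
  have in1 x : x \in [:: a; a + h; b] -> x \in `[a, b]%classic.
    by move=> xI; rewrite inE /=; exact: points_in.
  rewrite !in1 ?inE ?eqxx ?orbT//=; congr EFin; rewrite -[RHS]w2C; ring.
have mu3 : pts mu.
  rewrite /pts val; last by do 2 apply: measurableU => //.
  rewrite !(@mem_set _ (_ `|` _)) /=; [|by tauto..].
  by congr EFin; rewrite -[RHS]w2C; ring.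
split => //; have [_ ->] := real_energy_three_points mu_ab mu3.
have mem1 x y : (x \in [set y]) = (x == y).
  by apply/idP/eqP; rewrite inE.
rewrite !val//= !mem1 !eqxx (eq_sym b) (eq_sym b) (eq_sym (a + h) a).
rewrite (negbTE n1) (negbTE n2) (negbTE n3) /= !(mulr0, mulr1, addr0, add0r).
rewrite /level /gamma_function -/C !subr0.
have -> : w * (G 0 + C * G h + G (2 * h)) =
   w ^+ 2 * (2 + C) * (G 0 + C * G h + G (2 * h)) by rewrite expr2 -(mulrA w) w2C mulr1.
have := CE => /(congr1 (fun x => w ^+ 2 * C * x)).
by lra.
Qed.

(** The integral of the potential is at least the level, and at most the level
    by [real_energy_ge]; the excess of the potential over the level therefore
    vanishes almost everywhere, whereas it is positive off the three points. *)
Lemma carried_by_three_points (mu : probability (measurableTypeR R) R) :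
  M1 a b mu -> real_energy G mu a b <= level -> pts mu.
Proof.
move=> mu_ab le_level.
have mab : measurable (`[a, b]%classic : set (measurableTypeR R)).
  exact: measurable_itv.
pose U := discrete_potential G m.
have Uu : uniformly_continuous U by exact: discrete_potential_uc.
pose V x := U x - level.
have iU := integrable_on_itv mu a b Uu.
have icst : mu.-integrable `[a, b] (EFin \o cst level).
  exact: finite_measure_integrable_cst.
have iV : mu.-integrable `[a, b] (EFin \o V) := integrableB mab iU icst.
have V0 x : x \in `[a, b]%R -> 0 <= V x.
  by move=> xab; rewrite subr_ge0; exact: potential_ge.
have IV : \int[mu]_(x in `[a, b]) V x = 0.
  apply/eqP; rewrite eq_le; apply/andP; split; last first.
    by apply: Rintegral_ge0 => x xab; exact: V0.
  rewrite (RintegralB mab iU icst) Rintegral_cst_prob//.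
  have := real_energy_ge G_psd G_even G_uc mu_ab m; rewrite energy_m -/U; lra.
have absV0 : (\int[mu]_(x in `[a, b]) `|(EFin \o V) x| = 0)%E.
  transitivity (\int[mu]_(x in `[a, b]) (V x)%:E)%E.
    apply: eq_integral => x; rewrite inE => xab.
    by rewrite /= ger0_norm// V0.
  rewrite -[LHS]fineK; last exact: (integrable_fin_num mab iV).
  by rewrite -[fine _]/(Rintegral mu `[a, b] V) IV.
have [N [mN N0 subN]] :=
  (ae_eq_integral_abs mu mab (measurable_int mu iV)).1 absV0.
have m1 x : measurable ([set x] : set (measurableTypeR R)).
  exact: measurable_set1.
pose S : set (measurableTypeR R) := [set a] `|` ([set a + h] `|` [set b]).
have mS : measurable S by do 2 apply: measurableU => //.
have sub : `[a, b] `<=` S `|` N.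
  move=> x xab; have [xa|xa] := eqVneq x a; first by left; left.
  have [xah|xah] := eqVneq x (a + h); first by left; right; left.
  have [xb|xb] := eqVneq x b; first by left; right; right.
  right; apply: subN => /= /(_ xab) [] Vx0.
  by have := potential_gt xab xa xah xb; rewrite -subr_gt0 -/(V x) Vx0 ltxx.
apply/eqP; rewrite eq_le; apply/andP; split; first exact: probability_le1.
have <- : mu `[a, b] = 1%E by exact: mu_ab.
have <- : mu (S `|` N) = mu S by exact: measureU0.
by apply: le_measure => //; rewrite inE//; exact: measurableU.
Qed.

(** On differences of masses [(x, - (x + z), z)] of total mass zero, the energy is
    a combination of the squares of [x + z] and [x - z], with coefficients that
    are positive because [0 < C], [G h < G 0] and [G (2 * h) < G 0]. *)
Lemma minimizer_unique (mu : probability (measurableTypeR R) R) :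
  M1 a b mu -> real_energy G mu a b = level ->
  forall A : set (measurableTypeR R), measurable A -> mu A = mu_star C a h b A.
Proof.
move=> mu_ab mu_level A mA.
have mu3 : pts mu by apply: carried_by_three_points => //; rewrite mu_level.
have [n1 n2 n3] := points_neq.
have [pqr] := real_energy_three_points mu_ab mu3.
rewrite (three_points_measure _ _ _ mu3 mA)//.
set p := fine (mu [set a]) in pqr *; set q := fine (mu [set a + h]) in pqr *.
set r := fine (mu [set b]) in pqr *; rewrite mu_level => quad.
have w2C : w * (2 + C) = 1 by rewrite mulVf// gt_eqF.
have [pw qw rw] : [/\ p = w, q = w * C & r = w].
  pose x := p - w; pose z := r - w.
  pose A1 := G 0 - G h; pose B1 := G 0 - G (2 * h).
  have B1_gt0 : 0 < B1 by rewrite subr_gt0.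
  have A1_gt0 : 0 < A1 by rewrite subr_gt0.
  have CA : C * A1 = 2 * A1 - B1 by rewrite CE /A1 /B1; ring.
  (* Expanding around the candidate: the linear terms vanish because the
     potential is constant on the three points, and the difference of masses
     [(x, - (x + z), z)] has total mass zero. *)
  have level1 : w * (G 0 + C * G h + G (2 * h)) = level.
    by rewrite /level /gamma_function !subr0.
  have level2 : w * (2 * G h + C * G 0) = level.
    have := CE => /(congr1 (fun x => w * x)); rewrite -level1; lra.
  have form : (C * A1 + B1 / 2) * (x + z) ^+ 2 + B1 / 2 * (x - z) ^+ 2 = 0.
    have qE : q = 1 - p - r by rewrite -pqr; ring.
    have -> : (C * A1 + B1 / 2) * (x + z) ^+ 2 + B1 / 2 * (x - z) ^+ 2 =
        2 * A1 * (x + z) ^+ 2 - 2 * B1 * (x * z) by rewrite CA; field.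
    pose y := q - w * C.
    have yE : y = - (x + z) by rewrite /y /x /z qE; move: w2C; lra.
    have -> : 2 * A1 * (x + z) ^+ 2 - 2 * B1 * (x * z) =
        G 0 * (x ^+ 2 + y ^+ 2 + z ^+ 2) + 2 * G h * (x * y + y * z)
        + 2 * G (2 * h) * (x * z) by rewrite yE /A1 /B1; ring.
    have -> : G 0 * (x ^+ 2 + y ^+ 2 + z ^+ 2) + 2 * G h * (x * y + y * z)
        + 2 * G (2 * h) * (x * z) =
        G 0 * (p ^+ 2 + q ^+ 2 + r ^+ 2) + 2 * G h * (p * q + q * r)
        + 2 * G (2 * h) * (p * r)
        - 2 * (p * (w * (G 0 + C * G h + G (2 * h)))
             + q * (w * (2 * G h + C * G 0))
             + r * (w * (G 0 + C * G h + G (2 * h))))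
        + 2 * w * (w * (G 0 + C * G h + G (2 * h)))
        + w * C * (w * (2 * G h + C * G 0)).
      by rewrite /x /y /z; ring.
    rewrite -quad level1 level2 -!mulrDl pqr.
    have -> : level - 2 * (1 * level) + 2 * w * level + w * C * level =
      (w * (2 + C) - 1) * level by ring.
    by rewrite w2C subrr mul0r.
  have CA_gt0 : 0 < C * A1 by rewrite mulr_gt0.
  have xz1 : (x + z) ^+ 2 = 0.
    apply/eqP; rewrite eq_le sqr_ge0 andbT.
    have := sqr_ge0 (x + z); have := sqr_ge0 (x - z); nra.
  have xz2 : (x - z) ^+ 2 = 0.
    apply/eqP; rewrite eq_le sqr_ge0 andbT.
    have := sqr_ge0 (x + z); have := sqr_ge0 (x - z); nra.
  move/eqP: xz1; rewrite sqrf_eq0 => /eqP xz1.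
  move/eqP: xz2; rewrite sqrf_eq0 => /eqP xz2.
  have pw : p = w by move: xz1 xz2; rewrite /x /z; lra.
  have rw : r = w by move: xz1 xz2; rewrite /x /z; lra.
  split => //; move: pqr w2C; rewrite pw rw; lra.
rewrite /mu_star !diracE [RHS](_ : _ =
  (w * ((a \in A)%:R + C * (a + h \in A)%:R + (b \in A)%:R))%:E)//.
by rewrite pw qw rw; congr EFin; ring.
Qed.

End Optimal.

Lemma derivable_gamma_function (R : realType) (G : R -> R) (h t : R) :
  (forall x, derivable G x 1) -> derivable (gamma_function G h) t 1.
Proof.
move=> dG.
have dsub (c : R) : derivable (fun x : R => G (c - x)) t 1.
  apply/derivable1_diffP; apply: (@differentiable_comp _ _ _ _ (fun x : R => c - x)).
    by apply/derivable1_diffP.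
  exact/derivable1_diffP.
by apply: derivableD => //; apply: derivableD => //; apply: derivableM.
Qed.

Unset Implicit Arguments.

Theorem theorem2p12 (d : measure_display) (T : measurableType d) (R : realType)
  (P : probability T R) (Y : R -> {RV P >-> R}) (h : R) (Gamma : R -> R)
  (h_gt0 : 0 < h)
  (Y_gaussian : gaussian_process Y)
  (Y_centered : centered Y)
  (Y_continuous : continuous_paths Y)
  (* Processes with stationary increments start at 0 by convention, so that
     V_Y (t - s) is also the variance of Y t - Y s. *)
  (Y_0 : {ae P, forall w, Y 0 w = 0})
  (Y_stationary : stationary_increments Y)
  (* R(s, t) = Gamma (t - s), which determines Gamma on the whole of R. *)
  (Gamma_cov : forall s t : R, 0 <= s -> 0 <= t ->
     'E_P[increment_process Y h s \* increment_process Y h t]%E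
     = (Gamma (t - s))%:E)
  (f_C2 : C2_on `]0, +oo[%classic (increment_function Y h))
  (f'_gt0 : forall t : R, derivable (increment_function Y h) t 1 /\
                      0 < (increment_function Y h)^`() t)
  (* The point t = 0 is left out: f (- h - t) = - f t gives
     f'' (- h) = - f'' 0, so that no f satisfies the condition for t = 0 and
     beta = h. *)
  (f''_lt0 : forall beta t : R, 0 <= beta <= h -> 0 < t -> t != beta ->
     derivable (increment_function Y h)^`() (t - beta) 1 /\
     (increment_function Y h)^`(2)%classic t +
     (increment_function Y h)^`(2)%classic (t - beta) < 0)
  (C_gt0 : 0 < Cstar Gamma h)
  (gamma_crit_uniq : forall t1 t2 : R, 0 < t1 < h -> 0 < t2 < h ->
     critical_point (gamma_function Gamma h) t1 ->
     critical_point (gamma_function Gamma h) t2 -> t1 = t2)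
  (gamma_crit_max : forall t : R, 0 < t < h ->
     critical_point (gamma_function Gamma h) t ->
     local_max (gamma_function Gamma h) t)
  (a b : R) (ab_2h : b - a = 2 * h) :
  (exists2 mu : probability (measurableTypeR R) R,
     optimal_measure (fun s t => Gamma (t - s)) a b mu &
     forall A : set (measurableTypeR R), measurable A ->
       mu A = mu_star (Cstar Gamma h) a h b A) /\
  (forall mu : probability (measurableTypeR R) R,
     optimal_measure (fun s t => Gamma (t - s)) a b mu ->
     forall A : set (measurableTypeR R), measurable A ->
       mu A = mu_star (Cstar Gamma h) a h b A).
Proof.
have G_psd := Gamma_psd Y_gaussian h_gt0 Gamma_cov.
have G_even := Gamma_even Y_gaussian h_gt0 Gamma_cov.
have G_f := Gamma_increment_function Y_gaussian Y_centered Y_0 Y_stationary h_gt0 Gamma_cov.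
set f := increment_function Y h in G_f f_C2 f'_gt0 f''_lt0 *.
have df t : derivable f t 1 := (f'_gt0 t).1.
have dG t : derivable Gamma t 1.
  have -> : Gamma = (fun t => (f t - f (t - h)) / 2) by apply/funext.
  apply: derivableM => //; apply: derivableB => //.
  apply/derivable1_diffP.
  apply: (@differentiable_comp _ _ _ _ (fun x : R => x - h)).
    by apply/derivable1_diffP.
  exact/derivable1_diffP.
have G_uc : uniformly_continuous Gamma.
  apply: (psd_uniformly_continuous G_psd G_even).
  by apply: differentiable_continuous; apply/derivable1_diffP.
have d2f t : 0 < t -> derivable f^`() t 1 /\ f^`(2)%classic t < 0.
  move=> t0; split.
    by have [|_ ? _] := f_C2 t; first by rewrite /= in_itv/= t0.
  have [||_] := f''_lt0 0 t _ t0; rewrite ?lexx ?(ltW h_gt0) ?gt_eqF//.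
  by rewrite subr0; lra.
(* A return of [Gamma] to its maximum at [p] would give [Gamma (h + p) = Gamma h],
   against the strict concavity of [f]. *)
have G_lt p : h <= p -> Gamma p < Gamma 0.
  move=> hp; apply: (psd_lt0 G_psd G_even (u := h)).
  rewrite lt_eqF// !G_f subrr (_ : h + p - h = p); last by ring.
  rewrite ltr_pM2r ?invr_gt0// (addrC h).
  exact: concave_increment.
have G2h : Gamma (2 * h) < Gamma 0 by apply: G_lt; lra.
have Gh : Gamma h < Gamma 0 by exact: G_lt.
have gamma_gt t : 0 < t < h -> gamma_function Gamma h 0 < gamma_function Gamma h t.
  apply: gt_endpoints => // [x|]; first exact: derivable_gamma_function.
  by rewrite gamma_function0h.
have energy_ge nu : M1 a b nu ->
    (((2 + Cstar Gamma h)^-1 * gamma_function Gamma h 0)%:E <=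
     energy (fun s t => Gamma (t - s)%R) a b nu)%E.
  move=> nu_ab; rewrite energyE// lee_fin.
  exact: (real_energy_ge_level G_psd G_even G_uc ab_2h C_gt0 Gh gamma_gt).
have [mu muE] := mu_star_probability a h b C_gt0.
have [mu_ab mu_energy] := real_energy_mu_star G_even G_uc h_gt0 ab_2h C_gt0 Gh (fun A _ => muE A).
have sigmaE : sigma2_star (fun s t => Gamma (t - s)) a b =
    ((2 + Cstar Gamma h)^-1 * gamma_function Gamma h 0)%:E.
  apply/eqP; rewrite eq_le; apply/andP; split.
    by apply: ereal_inf_lbound; exists mu => //; rewrite energyE// mu_energy.
  by apply/ereal_infP => _ [nu nu_ab <-]; exact: energy_ge.
split; first by exists mu => //; split => //; rewrite energyE// mu_energy sigmaE.
move=> nu [nu_ab nu_opt] A mA.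
have nu_energy : real_energy Gamma nu a b =
    (2 + Cstar Gamma h)^-1 * gamma_function Gamma h 0.
  by apply: EFin_inj; rewrite -energyE// nu_opt sigmaE.
exact: (minimizer_unique G_psd G_even G_uc h_gt0 ab_2h C_gt0 Gh G2h gamma_gt).
Qed.
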